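(* Let $G=K_{n_1,n_2,\dots,n_t}$ be a complete $t$-partite graph with $n_1\le n_2\le\cdots\le n_t$, and let $k\ge 3$ be an integer with $k\le \sum_{i=1}^t n_i$. (1) If $k\ge t$, then $\tau_k(G)\le \left\lfloor \frac{\sum_{i=1}^t n_i-k}{2}\right\rfloor$. (2) If $k<t$, then $\tau_k(G)\le \sum_{i=k+1}^t n_i+\left\lfloor \frac{\sum_{i=1}^k n_i-k}{2}\right\rfloor$. Moreover, these upper bounds are sharp (attained by some complete multipartite graphs).
   Context: All graphs are finite, simple and undirected. For $S\subseteq V(G)$ with $|S|\ge 2$, a pedant $S$-Steiner tree is a subgraph of $G$ that is a tree containing $S$ in which every vertex of $S$ has degree exactly one. Two pedant $S$-Steiner trees $T,T'$ are internally disjoint if $E(T)\cap E(T')=\emptyset$ and $V(T)\cap V(T')=S$. $\tau_G(S)$ is the maximum number of pairwise internally disjoint pedant $S$-Steiner trees in $G$, and for $2\le k\le |V(G)|$, $\tau_k(G)=\min\{\tau_G(S): S\subseteq V(G),\ |S|=k\}$. *)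

(* Defs.v *)
From mathcomp Require Import all_boot.

Set Implicit Arguments.
Unset Strict Implicit.
Unset Printing Implicit Defensive.

Record sgraph := SGraph {
  svertex :> finType;
  adj : rel svertex;
  adj_sym : symmetric adj;
  adj_irr : irreflexive adj
}.

Definition edges (G : sgraph) : {set {set G}} :=
  [set [set x; y] | x : G, y : G in adj x].

Lemma edgesP (G : sgraph) (e : {set G}) :
  reflect (exists x y : G, adj x y /\ e = [set x; y]) (e \in edges G).
Proof.
apply: (iffP imset2P) => [[x y _]|[x [y [a ->]]]].
  by rewrite ?inE /= => h ->; exists x, y.
by exists x y; rewrite ?inE.
Qed.

(* A candidate subgraph is a pair (vertex set, edge set); it is a genuine
   subgraph only under [is_subgraph]. *)
Notation subgraph G := ({set svertex G} * {set {set svertex G}})%type.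

Section Trees.
Variable G : sgraph.
Implicit Types (S : {set G}) (T : subgraph G).

Definition is_subgraph T : bool :=
  (T.2 \subset edges G) && [forall e in T.2, e \subset T.1].

Definition subadj T : rel G := fun x y => [set x; y] \in T.2.

Definition subdeg T (x : G) : nat := #|[set e in T.2 | x \in e]|.

Definition connected_sub T : bool :=
  (T.1 != set0) && [forall x in T.1, forall y in T.1, connect (subadj T) x y].

(* Cycles are duplicate-free, so their length is at most #|G|; see [acyclicP].
   The bound 2 < m discards x - y - x, which [cycle] accepts as a cycle. *)
Definition acyclic_sub T : bool :=
  [forall m : 'I_#|G|.+1, forall c : m.-tuple G,
     (2 < m) ==> ~~ ucycleb (subadj T) c].

Lemma acyclicP T :
  reflect (forall c : seq G, 2 < size c -> ~ ucycle (subadj T) c)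
          (acyclic_sub T).
Proof.
apply: (iffP forallP) => [H c c2 cc|H m].
  have sz : size c < #|G|.+1.
    by rewrite ltnS -(card_uniqP (ucycle_uniq cc)) max_card.
  have /forallP/(_ (in_tuple c))/= := H (Ordinal sz).
  by rewrite c2 /= => /negP; apply; case/andP: cc => ? ?; apply/andP.
apply/forallP => c; apply/implyP => m2; apply/negP => /andP cc.
by apply: (H c); [rewrite size_tuple | apply/andP].
Qed.

Definition is_tree T : bool :=
  [&& is_subgraph T, connected_sub T & acyclic_sub T].

Definition pendant_steiner_tree S T : bool :=
  [&& is_tree T, S \subset T.1 & [forall x in S, subdeg T x == 1]].

Definition internally_disjoint S T T' : bool :=
  (T.2 :&: T'.2 == set0) && (T.1 :&: T'.1 == S).

Definition tree_packing S (F : {set subgraph G}) : bool :=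
  [forall T in F, pendant_steiner_tree S T] &&
  [forall T in F, forall T' in F, (T != T') ==> internally_disjoint S T T'].

Definition tau_set S : nat := \max_(F | tree_packing S F) #|F|.

(* The set of the first k vertices only serves as a default with k elements
   for the minimization; see [tau_kP]. The value is meaningful for
   2 <= k <= #|G|. *)
Definition tau_k (k : nat) : nat :=
  tau_set [arg min_(S < [set x in take k (enum G)] | #|S| == k) tau_set S].

Lemma tau_kP k : k <= #|G| ->
  (exists2 S : {set G}, #|S| = k & tau_k k = tau_set S) /\
  (forall S : {set G}, #|S| = k -> tau_k k <= tau_set S).
Proof.
move=> kG; rewrite /tau_k; case: arg_minnP => [|S /eqP cS minS].
  rewrite cardsE; apply/eqP; rewrite (card_uniqP _) ?take_uniq ?enum_uniq //.
  by rewrite size_takel // -cardE.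
by split=> [|S' cS']; [exists S | apply: minS; apply/eqP].
Qed.

End Trees.

Definition mp_adj (t : nat) (n : 'I_t -> nat) : rel {i : 'I_t & 'I_(n i)} :=
  fun x y => tag x != tag y.

Lemma mp_adj_sym t (n : 'I_t -> nat) : symmetric (@mp_adj t n).
Proof. by move=> x y; rewrite /mp_adj eq_sym. Qed.

Lemma mp_adj_irr t (n : 'I_t -> nat) : irreflexive (@mp_adj t n).
Proof. by move=> x; rewrite /mp_adj eqxx. Qed.

Definition complete_multipartite (t : nat) (n : 'I_t -> nat) : sgraph :=
  SGraph (@mp_adj_sym t n) (@mp_adj_irr t n).

(* Parts are nonempty and listed by nondecreasing size; the i-th part
   (i = 1, ..., t) has the 0-based index i.-1 : 'I_t. *)
Definition part_sizes (t : nat) (n : 'I_t -> nat) : Prop :=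
  (forall i, 0 < n i) /\ (forall i j : 'I_t, i <= j -> n i <= n j).

(* Main.v *)
(* When k >= 3, a pendant S-Steiner tree has at least two vertices outside S,
   unless its only one is adjacent to all of S. If S meets each of the first
   min(k, t) parts, such a hub lies in a later part, and counting the vertices
   outside S gives both bounds. They are attained by K_{1,...,1,2,2} with k
   parts and by the complete graph on k+1 vertices, where the bound is 1 and the
   vertices outside any k-set support a star or a double star. *)
Require Import Defs.
From mathcomp Require Import all_boot.

Set Implicit Arguments.
Unset Strict Implicit.
Unset Printing Implicit Defensive.

(** Serves to enlarge a choice of one vertex per part to a [k]-set without leaving the chosen
    parts. *)
Lemma exists_intermediate_set (T : finType) (A B : {set T}) (k : nat) :
  A \subset B -> #|A| <= k <= #|B| ->
  exists S : {set T}, [/\ A \subset S, S \subset B & #|S| = k].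
Proof.
move=> sAB /andP[Ak kB].
have /card_geqP[s [us ss sD]] : k - #|A| <= #|B :\: A|.
  by rewrite cardsD (setIidPr sAB) leq_sub2r.
exists (A :|: [set x in s]); split; first exact: subsetUl.
  rewrite subUset sAB; apply/subsetP=> x; rewrite inE => /sD.
  by rewrite inE => /andP[].
have dAs : [disjoint A & [set x in s]].
  rewrite disjoint_sym disjoints_subset; apply/subsetP=> x.
  by rewrite !inE => /sD; rewrite inE => /andP[].
move: (leq_card_setU A [set x in s]); rewrite dAs => -[_ /eqP->].
by rewrite cardsE (card_uniqP us) ss subnKC.
Qed.

(** * Leaves and internal vertices of pendant Steiner trees *)

Section PendantTrees.
Variable G : sgraph.
Implicit Types (S B A : {set G}) (T : subgraph G) (F : {set subgraph G}).

Lemma subadj_sym T : symmetric (subadj T).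
Proof. by move=> x y; rewrite /subadj setUC. Qed.

Lemma subadj_vertex T x y : is_subgraph T -> subadj T x y -> x \in T.1.
Proof.
case/andP=> _ /forall_inP sub /sub /subsetP-> //.
by rewrite inE set11.
Qed.

Lemma adj_subadj T x y : is_subgraph T -> subadj T x y -> adj x y.
Proof.
case/andP=> /subsetP sub _ /sub /edgesP[u [v [uv E]]].
have xy : x != y.
  apply/eqP=> Exy; have := cards2 u v; rewrite -E Exy setUid cards1.
  by case: eqVneq => // Euv; rewrite Euv adj_irr in uv.
have : x \in [set u; v] by rewrite -E !inE eqxx.
have : y \in [set u; v] by rewrite -E !inE eqxx orbT.
rewrite !inE => /orP[]/eqP Ey /orP[]/eqP Ex; subst x y => //.
- by rewrite eqxx in xy.
- by rewrite adj_sym.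
- by rewrite eqxx in xy.
Qed.

Lemma subdeg1_neighbor T x : subdeg T x = 1 -> is_subgraph T ->
  exists2 y, subadj T x y & forall z, subadj T x z -> z = y.
Proof.
move=> /eqP/cards1P[e Ee] sub.
have: e \in [set e in T.2 | x \in e] by rewrite Ee set11.
rewrite inE => /andP[eT xe].
have /andP[/subsetP/(_ _ eT)/edgesP[u [v [uv E]]] _] := sub.
have [y Ey] : exists y, e = [set x; y].
  move: xe; rewrite E !inE => /orP[]/eqP->; first by exists v.
  by exists u; rewrite setUC.
exists y => [|z xz]; first by rewrite /subadj -Ey.
have: [set x; z] \in [set e in T.2 | x \in e].
  by rewrite inE !inE eqxx andbT.
rewrite Ee inE Ey => /eqP Exz.
have: z \in [set x; y] by rewrite -Exz !inE eqxx orbT.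
rewrite !inE => /orP[]/eqP // Ezx; subst z.
by have := adj_subadj sub xz; rewrite adj_irr.
Qed.

Lemma terminal_neighbor S T s : 2 < #|S| -> pendant_steiner_tree S T ->
  s \in S -> exists2 y, y \in T.1 :\: S & adj s y.
Proof.
move=> S3 /and3P[/and3P[sub /andP[_ conn] _] sST /forall_inP deg] sS.
have [y sy uy] := subdeg1_neighbor (eqP (deg _ sS)) sub.
exists y; last exact: adj_subadj sub sy.
have ys : subadj T y s by rewrite subadj_sym.
rewrite inE (subadj_vertex sub ys) andbT; apply/negP=> yS.
(* Two adjacent leaves would form a whole connected component. *)
have [y' yy' uy'] := subdeg1_neighbor (eqP (deg _ yS)) sub.
have Es : s = y' by apply: uy'.
have clo : closed (subadj T) [set s; y].
  apply: intro_closed; first exact/sym_connect_sym/subadj_sym.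
  move=> a b ab; rewrite !inE => /orP[]/eqP Ea; subst a.
    by rewrite (uy _ ab) eqxx orbT.
  by rewrite (uy' _ ab) Es eqxx.
(* Connectedness puts all of [S] into this two-vertex component, against [2 < #|S|]. *)
have: S \subset [set s; y].
  apply/subsetP=> z zS; rewrite -(closed_connect clo (_ : connect _ s z)).
    by rewrite !inE eqxx.
  have sT := subsetP sST.
  by have /forall_inP/(_ _ (sT _ sS))/forall_inP/(_ _ (sT _ zS)) := conn.
by move/subset_leq_card/(leq_trans S3); rewrite cards2; case: (s != y).
Qed.

(** Since [T] meets [B] only inside [S], the neighbor [y] of a terminal lies outside both [S] and
    [B]. Some terminal is not adjacent to [y], and its own neighbor is a second such vertex. *)
Lemma pendant_internal_gt1 S B T : 2 < #|S| ->
  (forall v, v \notin S :|: B -> exists2 s, s \in S & ~~ adj s v) ->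
  pendant_steiner_tree S T -> T.1 :&: B \subset S ->
  1 < #|T.1 :&: ~: (S :|: B)|.
Proof.
move=> S3 nohub tree TB.
have out y : y \in T.1 :\: S -> y \in T.1 :&: ~: (S :|: B).
  rewrite !inE negb_or => /andP[yS yT]; rewrite yT yS /=.
  by apply: contra yS => yB; apply: (subsetP TB); rewrite inE yT.
have /card_gt0P[s sS] : 0 < #|S| by exact: leq_trans S3.
have [y /out yI _] := terminal_neighbor S3 tree sS.
have: y \notin S :|: B by move: yI; rewrite 2!inE => /andP[].
case/nohub=> s' s'S nadj.
have [y' /out y'I s'y'] := terminal_neighbor S3 tree s'S.
rewrite (cardsD1 y) yI ltnS; apply/card_gt0P; exists y'.
by rewrite in_setD1 y'I andbT; apply: contraNneq nadj => <-.
Qed.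

(** * Upper bound by counting the vertices outside [S] *)

(** Double counting of pairs [(T, x)] with [x] in [T.1 :&: A]: distinct trees share only vertices of
    [S], so each vertex of [A] lies in at most one tree. *)
Lemma packing_count S F F' A c : tree_packing S F -> F' \subset F ->
  [disjoint A & S] -> (forall T, T \in F' -> c <= #|T.1 :&: A|) ->
  #|F'| * c <= #|A|.
Proof.
move=> /andP[_ /forall_inP disj] sF dAS cF.
rewrite -sum_nat_const; apply: (@leq_trans (\sum_(T in F') #|T.1 :&: A|)).
  by apply: leq_sum => T; apply: cF.
have -> : \sum_(T in F') #|T.1 :&: A| =
          \sum_(x in A) \sum_(T in F') (x \in T.1 : nat).
  rewrite exchange_big; apply: eq_bigr => T _.
  rewrite -sum1_card -big_mkcondr /=.
  by apply: eq_bigl => x; rewrite inE andbC.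
rewrite -sum1_card; apply: leq_sum => x xA.
rewrite -big_mkcondr sum1_card; apply/card_le1_eqP => T T'.
move=> /andP[TF xT] /andP[T'F xT']; apply: contraTeq xA => TT'.
have /forall_inP/(_ _ (subsetP sF _ T'F)) := disj _ (subsetP sF _ TF).
rewrite eq_sym TT' => /andP[_ /eqP E].
have xS : x \in S by rewrite -E inE xT xT'.
by apply/negP=> xA; rewrite (disjointFr dAS xA) in xS.
Qed.

(* A tree avoiding [B] has at least two internal vertices, because a single one
   would be adjacent to all of [S]. *)
Lemma tau_set_le S B : 2 < #|S| -> [disjoint B & S] ->
  (forall v, v \notin S :|: B -> exists2 s, s \in S & ~~ adj s v) ->
  tau_set S <= #|B| + #|~: (S :|: B)|./2.
Proof.
move=> S3 dBS nohub; apply/bigmax_leqP => F packF.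
have /andP[/forall_inP treeF _] := packF.
(* Trees meeting [B] each use up a vertex of [B]; the remaining ones each use up two vertices
   outside [S :|: B]. *)
rewrite -(cardsID [set T : subgraph G | T.1 :&: B != set0] F) leq_add //.
  rewrite -[leqLHS]muln1; apply: (packing_count packF) => //.
    exact: subsetIl.
  by move=> T; rewrite !inE card_gt0 => /andP[].
rewrite geq_half_double -muln2; apply: (packing_count packF).
- exact: subsetDl.
- by rewrite disjoint_sym disjoints_subset setCK subsetUl.
move=> T; rewrite !inE negbK => /andP[/eqP TB /treeF treeT].
by apply: pendant_internal_gt1 => //; rewrite TB sub0set.
Qed.

(** * Construction of trees with at most two internal vertices *)

(** After rotating [x] to the front, its successor [y] and predecessor [z] are distinct because the
    cycle is longer than 2, so they give two different edges at [x]. *)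
Lemma cycle_neighbors T c x : 2 < size c -> ucycle (subadj T) c -> x \in c ->
  1 < subdeg T x.
Proof.
move=> c3 /andP[cyc uc] /rot_to[i c' Ec].
move: cyc uc c3; rewrite -(rot_cycle i) -(rot_uniq i) -(size_rot i) Ec.
case: c' {Ec} => [|y p] //; case/lastP: p => [|p z] //=.
rewrite rcons_path last_rcons => /andP[xy /andP[_ zx]].
rewrite inE mem_rcons inE !negb_or => /andP[/and3P[nxy nxz _]].
rewrite mem_rcons inE negb_or => /andP[/andP[nyz _] _] _.
have xyT : [set x; y] \in [set e in T.2 | x \in e].
  by rewrite inE !inE eqxx andbT.
rewrite /subdeg (cardsD1 [set x; y]) xyT ltnS; apply/card_gt0P.
exists [set z; x]; rewrite in_setD1 inE !inE eqxx orbT andbT.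
apply/andP; split=> //.
apply/eqP=> E; have: y \in [set z; x] by rewrite E !inE eqxx orbT.
by rewrite !inE (negPf nyz) eq_sym (negPf nxy).
Qed.

(* All vertices of a cycle have degree at least 2, hence are internal. *)
Lemma pendant_acyclic S T : is_subgraph T ->
  (forall s, s \in S -> subdeg T s = 1) -> #|T.1 :\: S| <= 2 -> acyclic_sub T.
Proof.
move=> sub deg TS2; apply/acyclicP => c c3 cc.
suff: #|[set x in c]| <= #|T.1 :\: S|.
  rewrite cardsE (card_uniqP (ucycle_uniq cc)) => h.
  by have := leq_trans c3 (leq_trans h TS2).
apply/subset_leq_card/subsetP=> x; rewrite !inE => xc.
have d := cycle_neighbors c3 cc xc.
apply/andP; split; first by apply: contraL d => /deg ->.
by have /andP[cyc _] := cc; exact: subadj_vertex sub (next_cycle cyc xc).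
Qed.

(* The case [v = w] covers stars. *)
Lemma double_star_pendant S v w : v \notin S -> w \notin S ->
  (v == w) || adj w v -> (forall s, s \in S -> adj s v || adj s w) ->
  exists T, pendant_steiner_tree S T.
Proof.
move=> vS wS vw Svw; pose V := S :|: [set v; w].
(* [f x] is the parent of [x] in the tree rooted at [v]. If [v] and [w] differ, then [f w = v],
   which yields the central edge. *)
pose f x := if adj x v then v else w.
pose T : subgraph G := (V, [set [set x; f x] | x in V :\ v]).
have fvw x : (f x == v) || (f x == w).
  by rewrite /f; case: ifP; rewrite eqxx ?orbT.
have vV : v \in V by rewrite !inE eqxx orbT.
have wV : w \in V by rewrite !inE eqxx !orbT.
have adjf x : x \in V :\ v -> adj x (f x).
  rewrite !inE /f => /andP[xv]; rewrite (negPf xv); case: ifP => // nxv.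
  case/orP=> [/Svw|/eqP Ex]; first by rewrite nxv.
  by subst x; move: vw; rewrite eq_sym (negPf xv) nxv.
have Tf x : x \in V :\ v -> subadj T x (f x).
  by move=> xV; apply/imsetP; exists x.
have sub : is_subgraph T.
  apply/andP; split; first apply/subsetP=> _ /imsetP[x xV ->].
    by apply/edgesP; exists x, (f x); rewrite adjf.
  apply/forall_inP=> _ /imsetP[x /setD1P[_ xV] ->].
  by rewrite subUset !sub1set xV; by case/orP: (fvw x) => /eqP->.
have toV x : x \in V -> connect (subadj T) x v.
  have wv : connect (subadj T) w v.
    case/orP: vw => [/eqP-> //|awv]; apply: connect1.
    have -> : v = f w by rewrite /f awv.
    apply: Tf; rewrite inE wV andbT inE.
    by apply: contraTneq awv => ->; rewrite adj_irr.
  move=> xV; have [->//|xv] := eqVneq x v.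
  have xfx : connect (subadj T) x (f x).
    by apply/connect1/Tf; rewrite 2!inE xv.
  by apply: connect_trans xfx _; by case/orP: (fvw x) => /eqP->.
have conn : connected_sub T.
  apply/andP; split; first by apply/set0Pn; exists v.
  apply/forall_inP=> x xV; apply/forall_inP=> y yV.
  apply: connect_trans (toV _ xV) _.
  by rewrite sym_connect_sym; [exact: toV | exact: subadj_sym].
have deg s : s \in S -> subdeg T s = 1.
  move=> sS; apply/eqP/cards1P; exists [set s; f s].
  have sv : s != v by apply: contraNneq vS => <-.
  apply/setP=> e; rewrite !inE; apply/andP/eqP=> [[]|->]; last first.
    by split; [apply: Tf; rewrite !inE sv sS | rewrite !inE eqxx].
  (* An edge at [s] other than the one to its parent would make [s] a parent, hence [v] or [w], but
     neither is in [S]. *)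
  case/imsetP=> x xV -> ; rewrite !inE => /orP[/eqP-> //|/eqP Es].
  by have := fvw x; rewrite -Es (negPf sv) => /eqP E; rewrite -E sS in wS.
exists T; apply/and3P; split; last by apply/forall_inP=> s /deg->.
- apply/and3P; split=> //; apply: (pendant_acyclic sub deg).
  rewrite setDUl setDv set0U.
  apply: leq_trans (subset_leq_card (subsetDl _ _)) _.
  by rewrite cards2; case: (v != w).
- exact: subsetUl.
Qed.

Lemma tau_set_gt0 S T : pendant_steiner_tree S T -> 0 < tau_set S.
Proof.
move=> tree; rewrite -(cards1 T).
apply: (leq_bigmax_cond (F := fun F : {set subgraph G} => #|F|)).
apply/andP; split; first by apply/forall_inP=> T' /set1P->.
apply/forall_inP=> T1 /set1P->; apply/forall_inP=> T2 /set1P->.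
by rewrite eqxx.
Qed.

Lemma tau_k_gt0 k : k <= #|G| ->
  (forall S, #|S| = k -> exists T, pendant_steiner_tree S T) ->
  0 < tau_k G k.
Proof.
move=> kG h; have [[S /h[T tree] ->] _] := tau_kP kG.
exact: tau_set_gt0 tree.
Qed.

End PendantTrees.

(** * Upper bounds for complete multipartite graphs *)

Section CompleteMultipartite.
Variables (t : nat) (n : 'I_t -> nat).
Local Notation K := (complete_multipartite n).

Lemma card_parts (P : pred 'I_t) :
  #|[set x : K | P (tag x)]| = \sum_(i | P i) n i.
Proof.
rewrite cardsE -sum1_card.
under [RHS]eq_bigr => i _ do rewrite -[n i]card_ord -sum1_card.
by rewrite sig_big_dep; apply: eq_bigl => x; rewrite andbT.
Qed.

Lemma card_multipartite : #|K| = \sum_i n i.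
Proof. by rewrite -(card_parts predT) cardsT. Qed.

(* [S] takes a vertex in each of the first [k] parts, so only the vertices of
   the other parts can be adjacent to all of [S]. *)
Lemma tau_k_multipartite_le k : (forall i, 0 < n i) -> 2 < k ->
  k <= \sum_(i < t | i < k) n i ->
  tau_k K k <= \sum_(i < t | k <= i) n i + (\sum_(i < t | i < k) n i - k)./2.
Proof.
move=> n0 k3 kn; pose r i : K := Tagged (fun i => 'I_(n i)) (Ordinal (n0 i)).
pose P : {set K} := [set x : K | tag x < k].
pose B : {set K} := [set x : K | k <= tag x].
pose R := r @: [set i : 'I_t | i < k].
have RP : R \subset P by apply/subsetP=> _ /imsetP[i + ->]; rewrite !inE.
(* There may be fewer than [k] parts; [P] then supplies the missing vertices of [S]. *)
have Rk : #|R| <= k.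
  apply: leq_trans (leq_imset_card _ _) _; rewrite cardE.
  rewrite -(size_map val) -[leqRHS](size_iota 0); apply: uniq_leq_size.
    by rewrite map_inj_uniq ?enum_uniq //; exact: val_inj.
  by move=> _ /mapP[i + ->]; rewrite mem_enum inE mem_iota.
have Pn : #|P| = \sum_(i < t | i < k) n i by exact: card_parts.
have kP : #|R| <= k <= #|P| by rewrite Rk Pn.
have [S [RS SP Sk]] := exists_intermediate_set RP kP.
have CB : ~: (S :|: B) = P :\: S.
  by apply/setP=> x; rewrite !inE negb_or -ltnNge.
have kK : k <= #|K| by rewrite -Sk max_card.
have [_ /(_ _ Sk) h] := tau_kP kK; apply: leq_trans h _.
have -> : \sum_(i < t | i < k) n i - k = #|~: (S :|: B)|.
  by rewrite CB cardsD (setIidPr SP) Sk Pn.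
rewrite -(card_parts (fun i => k <= i)); apply: tau_set_le; first by rewrite Sk.
  rewrite disjoint_sym disjoints_subset; apply: subset_trans SP _.
  by apply/subsetP=> x; rewrite !inE ltnNge.
(* Such a [v] lies in one of the first [k] parts, so it is not adjacent to the representative of its
   own part. *)
move=> v; rewrite !inE negb_or -ltnNge => /andP[_ vk]; exists (r (tag v)).
  by apply/(subsetP RS)/imsetP; exists (tag v); rewrite ?inE.
by rewrite /= /mp_adj negbK.
Qed.

Lemma tau_k_le_few_parts k : (forall i, 0 < n i) -> 2 < k ->
  k <= \sum_i n i -> t <= k -> tau_k K k <= (\sum_i n i - k)./2.
Proof.
move=> n0 k3 kn tk.
have lek (i : 'I_t) : i < k by exact: leq_trans (ltn_ord i) tk.
have E : \sum_(i < t | i < k) n i = \sum_i n i.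
  by apply: eq_bigl => i; rewrite lek.
have E0 : \sum_(i < t | k <= i) n i = 0.
  by apply: big_pred0 => i; rewrite leqNgt lek.
by have := tau_k_multipartite_le n0 k3; rewrite E E0; apply.
Qed.

Lemma tau_k_le_many_parts k : (forall i, 0 < n i) -> 2 < k -> k < t ->
  tau_k K k <= \sum_(i < t | k <= i) n i + (\sum_(i < t | i < k) n i - k)./2.
Proof.
move=> n0 k3 kt; apply: tau_k_multipartite_le => //.
rewrite (big_ord_narrow (ltnW kt)) -[leqLHS]card_ord -sum1_card.
exact: leq_sum.
Qed.

(** * Sharpness examples *)

(** Exactly two vertices [v], [w] lie outside [S]. In different parts they are the centers of a
    double star; in the same part they fill it, so [v] is adjacent to all of [S] and a star
    works. *)
Lemma tau_k_multipartite_gt0 k : (forall i, n i <= 2) ->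
  \sum_i n i = k.+2 -> 0 < tau_k K k.
Proof.
move=> n2 nk; have cK : #|K| = k.+2 by rewrite card_multipartite.
apply: tau_k_gt0 => [|S Sk]; first by rewrite cK !leqW.
have: #|~: S| == 2 by rewrite cardsCs setCK cK Sk -addn2 addKn.
case/cards2P=> v [w [vw E]].
have vS : v \notin S by rewrite -in_setC E !inE eqxx.
have wS : w \notin S by rewrite -in_setC E !inE eqxx orbT.
have [tvw|tvw] := eqVneq (tag v) (tag w); last first.
  apply: (double_star_pendant vS wS).
    by rewrite /= /mp_adj [tag w == _]eq_sym tvw orbT.
  move=> s _; rewrite /= /mp_adj -negb_and; apply: contraNN tvw.
  by case/andP=> /eqP<-.
apply: (double_star_pendant vS vS) => [|s sS]; first by rewrite eqxx.
rewrite orbb /= /mp_adj; apply/negP=> /eqP sv.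
have := n2 (tag v); have := card_parts (pred1 (tag v)).
rewrite big_pred1_eq => <-; apply/negP; rewrite -ltnNge.
apply/card_gt2P; exists s, v, w; rewrite !inE sv tvw eqxx; split=> //.
split=> //; last by apply: contraNneq wS => ->.
by apply: contraNneq vS => <-.
Qed.

End CompleteMultipartite.

Lemma tau_k_complete_gt0 k :
  0 < tau_k (complete_multipartite (fun _ : 'I_k.+1 => 1)) k.
Proof.
set K := complete_multipartite _.
have cK : #|K| = k.+1 by rewrite card_multipartite sum_nat_const card_ord muln1.
apply: tau_k_gt0 => [|S Sk]; first by rewrite cK leqW.
have /cards1P[v E]: #|~: S| == 1 by rewrite cardsCs setCK cK Sk subSnn.
have vS : v \notin S by rewrite -in_setC E set11.
apply: (double_star_pendant vS vS) => [|s sS]; first by rewrite eqxx.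
rewrite orbb /= /mp_adj; apply: contraNneq vS => tvs.
suff -> : v = s by [].
by case: v s tvs {E sS} => [i a] [j b] /= Eij; subst j; rewrite !ord1.
Qed.

Theorem theorem2 :
  (forall (t : nat) (n : 'I_t -> nat) (k : nat),
     part_sizes n -> 3 <= k -> k <= \sum_(i < t) n i ->
     (t <= k ->
        tau_k (complete_multipartite n) k <= (\sum_(i < t) n i - k)./2) /\
     (k < t ->
        tau_k (complete_multipartite n) k <=
          \sum_(i < t | k <= i) n i + (\sum_(i < t | i < k) n i - k)./2)) /\
  (forall k : nat, 3 <= k ->
     (exists (t : nat) (n : 'I_t -> nat),
        [/\ part_sizes n, k <= \sum_(i < t) n i, t <= k,
            0 < tau_k (complete_multipartite n) k
          & tau_k (complete_multipartite n) k = (\sum_(i < t) n i - k)./2]) /\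
     (exists (t : nat) (n : 'I_t -> nat),
        [/\ part_sizes n, k <= \sum_(i < t) n i, k < t,
            0 < tau_k (complete_multipartite n) k
          & tau_k (complete_multipartite n) k =
              \sum_(i < t | k <= i) n i
              + (\sum_(i < t | i < k) n i - k)./2])).
Proof.
split=> [t n k [n0 _] k3 kn|k k3].
  by split=> tk; [apply: tau_k_le_few_parts | apply: tau_k_le_many_parts].
split.
  (* All parts are singletons except the last two, of size 2; the total [k + 2] makes the bound
     1. *)
  pose n (i : 'I_k) := (k - 2 <= i).+1.
  have nk : \sum_i n i = k.+2.
    have -> : \sum_i n i = k + \sum_(i < k) (k - 2 <= i).
      by rewrite -[X in X + _]card_ord -sum1_card -big_split.
    case: k k3 {n} => [|[|k]] // _; rewrite subn2 /= !big_ord_recr /=.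
    rewrite big1 ?leqnn ?leqnSn ?addn2 // => i _.
    by rewrite leqNgt ltn_ord.
  have pn : part_sizes n.
    split=> // i j ij; rewrite ltnS.
    by case: (leqP _ i) => // /leq_trans->.
  have tau0 : 0 < tau_k (complete_multipartite n) k.
    by apply: tau_k_multipartite_gt0 => // i; rewrite ltnS leq_b1.
  have kn : k <= \sum_i n i by rewrite nk !leqW.
  exists k, n; split=> //; apply/eqP; rewrite eqn_leq.
  rewrite tau_k_le_few_parts ?(proj1 pn) //.
  by rewrite nk -addn2 addKn.
(* With [k + 1] singleton parts only the last one contributes to the first sum and the halved term
   vanishes, so the bound is 1. *)
have pn : part_sizes (fun _ : 'I_k.+1 => 1) by [].
have nk : \sum_(i < k.+1) 1 = k.+1 by rewrite sum_nat_const card_ord muln1.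
have kn : k <= \sum_(i < k.+1) 1 by rewrite nk.
exists k.+1, (fun=> 1); split=> //; first exact: tau_k_complete_gt0.
apply/eqP; rewrite eqn_leq tau_k_le_many_parts //=.
have -> : \sum_(i < k.+1 | k <= i) 1 = 1.
  rewrite (big_pred1 ord_max) // => i.
  by rewrite /= -val_eqE /= eqn_leq -[i <= k]ltnS ltn_ord.
rewrite (big_ord_narrow (leqnSn k)) sum_nat_const card_ord muln1 subnn.
exact: tau_k_complete_gt0.
Qed.
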